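(* Let $\mathfrak C$ be a finitely aligned, left cancellative, countable small category and $\mathfrak S$ a Garside family in $\mathfrak C$ with $\mathfrak S \cap \mathfrak C^* = \emptyset$ which is $=^*$-transverse and locally bounded. Let $I_l\ltimes\Omega$ be the groupoid model for $C^*_\lambda(\mathfrak C)$. Then there is a one-to-one correspondence between closed invariant subspaces of $I_l\ltimes\Omega$ (that is, closed invariant subspaces of its unit space $\Omega$) and admissible, $H$-invariant, $\max_{\preceq}^{\infty}$-closed pairs $(\mathfrak T,\mathfrak D)$ with $\mathfrak T\subseteq\mathfrak S$ and $\mathfrak D\subseteq\mathfrak C^0$.
   Context: **Categories.** $\mathfrak C$ denotes the set of morphisms of a small category, $\mathfrak C^0\subseteq\mathfrak C$ the set of identity morphisms (identified with the objects), $\mathfrak d,\mathfrak t:\mathfrak C\to\mathfrak C^0$ the domain and target maps; $cd$ is defined iff $\mathfrak d(c)=\mathfrak t(d)$. $\mathfrak C$ is left cancellative if $cx=cy$ implies $x=y$. $\mathfrak C^*$ is the set of invertible elements. For $c\in\mathfrak C$ and $S\subseteq\mathfrak C$, $cS=\{cs: s\in S,\ \mathfrak t(s)=\mathfrak d(c)\}$. $\mathfrak C$ is finitely aligned if for all $a,b\in\mathfrak C$ there is a finite $F\subseteq\mathfrak C$ with $a\mathfrak C\cap b\mathfrak C=\bigcup_{c\in F}c\mathfrak C$. **Groupoid.** Each $c\in\mathfrak C$ gives the partial bijection $\mathfrak d(c)\mathfrak C\to c\mathfrak C$, $x\mapsto cx$; $I_l$ is the smallest semigroup of partial bijections of $\mathfrak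 C$ containing these and closed under inverses; $\mathcal J=\{\mathrm{dom}(s):s\in I_l\}$ is its semilattice of idempotents (product = intersection). $\widehat{\mathcal J}$ is the space of non-zero multiplicative maps $\chi:\mathcal J\to\{0,1\}$ with $\chi(\emptyset)=0$ if $\emptyset\in\mathcal J$ (topology of pointwise convergence). $\Omega\subseteq\widehat{\mathcal J}$ is the subspace of those $\chi$ such that whenever $e=\bigcup_{i=1}^n f_i$ with $e,f_1,\dots,f_n\in\mathcal J$ and $\chi(e)=1$, then $\chi(f_i)=1$ for some $i$. $s\in I_l$ acts by $\{\chi\in\Omega:\chi(s^{-1}s)=1\}\to\{\chi\in\Omega:\chi(ss^{-1})=1\}$, $\chi\mapsto s.\chi=\chi(s^{-1}\,\cdot\, s)$, and $I_l\ltimes\Omega$ is the corresponding transformation groupoid (classes $[s,\chi]$ with $\chi(s^{-1}s)=1$; $[s,\chi]=[t,\chi]$ iff $se=te$ for some $e\in\mathcal J$ with $\chi(e)=1$; source $\chi$, range $s.\chi$). A subset $X\subseteq\Omega$ is invariant iff $s.\chi\in X$ whenever $s\in I_l$, $\chi\in X$ and $\chi(s^{-1}s)=1$. $C^*_\lambda(\mathfrak C)\subseteq\mathcal L(\ell^2\mathfrak C)$ is the C*-algebra generated by the partial isometries $\lambda_c$ ($c\in\mathfrak C$), where $\lambda_c\delta_x=\delta_{cx}$ if $\mathfrak t(x)=\mathfrak d(c)$ and $\lambda_c\delta_x=0$ otherwise. **Garside families.** $a\preceq b$ means $b\in a\mathfrak C$; $a\prec b$ means $b\mathfrak C\subsetneq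 a\mathfrak C$; $a=^*b$ means $a\in b\mathfrak C^*$; $a$ is a right divisor of $b$ if $b\in\mathfrak Ca$. $\mathfrak S$ is $=^*$-transverse if $s_1,s_2\in\mathfrak S$, $s_1=^*s_2$ imply $s_1=s_2$. $\mathfrak S$ is locally bounded if for every $\mathfrak v\in\mathfrak C^0$ there is no infinite sequence $s_1\prec s_2\prec\cdots$ in $\mathfrak v\mathfrak S$. A path is a finite or infinite sequence $s_1s_2\cdots$ in $\mathfrak C$ with $\mathfrak d(s_k)=\mathfrak t(s_{k+1})$ for all $k$. Put $\mathfrak S^\sharp=\mathfrak S\mathfrak C^*\cup\mathfrak C^*$. $\mathfrak S$ is a Garside family if: (1) it is closed under right comultiples (for $r,s\in\mathfrak S$, $a\in\mathfrak C$ with $r\preceq a$, $s\preceq a$ there is $t\in\mathfrak S$ with $r\preceq t$, $s\preceq t$, $t\preceq a$); (2) $\mathfrak S\cup\mathfrak C^*$ generates $\mathfrak C$; (3) $\mathfrak S^\sharp$ is closed under right divisors; (4) every $a\in\mathfrak C$ equals $s_1\cdots s_l$ for some normal path $s_1\cdots s_l$ in $\mathfrak S^\sharp$, where a path $s_1s_2\cdots$ in $\mathfrak S^\sharp$ is normal if for all $k$ (for which $s_{k+1}$ is defined) and all $r\in\mathfrak S$, $r\preceq s_ks_{k+1}$ implies $r\preceq s_k$. For $a\in\mathfrak C\setminus\mathfrak C^*$, $H(a)$ denotes the unique $s\in\mathfrak S$ with $s\preceq a$ such that every $r\in\mathfrak S$ with $r\preceq a$ satisfies $r\preceq s$. **Limits.**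 For a sequence $(s_i)$ in $\mathfrak S$ and $s\in\mathfrak S\cup\mathfrak C^0$, write $\lim_i s_i=s$ if $s$ is maximal with respect to $\preceq$ among $\{r\in\mathfrak S\cup\mathfrak C^0: r\preceq s_i\text{ for almost all }i\}$. **Conditions on pairs** $(\mathfrak T,\mathfrak D)$ with $\mathfrak T\subseteq\mathfrak S$, $\mathfrak D\subseteq\mathfrak C^0$: - admissible: for every $t\in\mathfrak T$, there is $t'\in\mathfrak T$ such that $tt'$ is normal, or $\mathfrak d(t)\in\mathfrak D$; - $H$-invariant: for all $a\in\mathfrak C\setminus\mathfrak C^*$ and $x\in\mathfrak T\cup\mathfrak D$ with $\mathfrak d(a)=\mathfrak t(x)$, $H(ax)$ lies in $\mathfrak T$; - $\max_\preceq^\infty$-closed: for every sequence $(t_i)$ in $\mathfrak T$, if $\lim_i t_i$ exists in $\mathfrak S$, then $\lim_i t_i\in\mathfrak T\cup\mathfrak D$.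
   Formalization: As stated this fails; in the formal theorem pairs also need D closed under isomorphism of objects, limits in the max-closed condition may lie in C^0 as well as S, and count only for sequences where each r in S ∪ C^0 eventually always or eventually never divides t_i. *)

(* Defs.v *)
From Stdlib Require List.
From mathcomp Require Import all_boot.
From mathcomp Require Import all_classical.
From mathcomp Require Import topology.

Set Implicit Arguments.
Unset Strict Implicit.
Unset Printing Implicit Defensive.

Local Open Scope classical_set_scope.

(* One-sorted presentation: an object is identified with its identity
   morphism. [mul c x] is the product cx ("x first"), meaningful only when
   [dom c = cod x]; it carries a junk value otherwise. *)
Record smallCategory := SmallCategory {
  mor :> Type;
  dom : mor -> mor;
  cod : mor -> mor;
  mul : mor -> mor -> mor;
  dom_dom : forall c, dom (dom c) = dom c;
  cod_dom : forall c, cod (dom c) = dom c;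
  dom_cod : forall c, dom (cod c) = cod c;
  cod_cod : forall c, cod (cod c) = cod c;
  dom_mul : forall c x, dom c = cod x -> dom (mul c x) = dom x;
  cod_mul : forall c x, dom c = cod x -> cod (mul c x) = cod c;
  mul_id : forall c, mul c (dom c) = c;
  id_mul : forall c, mul (cod c) c = c;
  mulA : forall a b c, dom a = cod b -> dom b = cod c ->
    mul a (mul b c) = mul (mul a b) c
}.

Section Category.
Variable C : smallCategory.
Implicit Types (a b c r u v x : C) (A S : set C).

Definition objects : set C := [set v | dom v = v].

Definition units : set C := [set a | exists b, [/\ dom a = cod b,
  dom b = cod a, mul a b = cod a & mul b a = dom a]].

Definition lmul c A : set C := [set mul c x | x in [set x | A x /\ cod x = dom c]].

Definition left_cancellative := forall c x y,
  dom c = cod x -> dom c = cod y -> mul c x = mul c y -> x = y.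

Definition finitely_aligned := forall a b, exists2 F : set C,
  finite_set F & lmul a setT `&` lmul b setT = \bigcup_(c in F) lmul c setT.

(* A partial bijection is represented by its graph, the set of pairs
   (x, s(x)); [(s \; t)%relation] is the graph of "t first, then s". *)
Definition transl c : set (C * C) :=
  [set xy | dom c = cod xy.1 /\ xy.2 = mul c xy.1].

Inductive Il : set (set (C * C)) :=
| Il_transl c : Il (transl c)
| Il_inv (s : set (C * C)) : Il s -> Il (s^-1)%relation
| Il_comp (s t : set (C * C)) : Il s -> Il t -> Il (s \; t)%relation.

Definition pdom (s : set (C * C)) : set C := [set x | exists y, s (x, y)].

Definition J : set (set C) := [set pdom s | s in Il].

(* The domain of the idempotent s^-1 e s. *)
Definition preim (s : set (C * C)) (e : set C) : set C :=
  [set x | exists2 y, s (x, y) & e y].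

Lemma J_pdom (s : Il) : J (pdom (val s)).
Proof. by exists (val s) => //; exact: set_valP. Qed.

Lemma J_preim (s : Il) (e : J) : J (preim (val s) (val e)).
Proof.
have [t It te] := set_valP e.
exists (t \; val s)%relation; first exact: Il_comp It (set_valP s).
rewrite -te; apply/seteqP; split => x /=.
  by move=> [z [y sxy tyz]]; exists y => //; exists z.
by move=> [y sxy [z tyz]]; exists z; exists y.
Qed.

Definition domJ (s : Il) : J := SigSub (mem_set (J_pdom s)).
Definition pullback (s : Il) (e : J) : J := SigSub (mem_set (J_preim s e)).

Definition charSpace := prod_topology (fun _ : J => bool).

Definition Jhat : set charSpace := [set chi : charSpace |
  [/\ exists e, chi e,
      forall e f g : J, val g = val e `&` val f -> chi g = chi e && chi f
    & forall e : J, val e = set0 -> chi e = false]].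

Definition Omega : set charSpace := [set chi : charSpace | Jhat chi /\
  forall (e : J) (n : nat) (f : 'I_n -> J),
    val e = \bigcup_(i in setT) val (f i) -> chi e -> exists i, chi (f i)].

Definition act (s : Il) (chi : charSpace) : charSpace :=
  fun e => chi (pullback s e).

Definition invariant_set (X : set charSpace) :=
  forall (s : Il) (chi : charSpace), X chi -> chi (domJ s) -> X (act s chi).

(* Sets of characters contained in [Omega]; closedness is relative to it. *)
Definition closed_invariant : set (set charSpace) := [set X |
  [/\ X `<=` Omega, closed (X : set (subspace Omega)) & invariant_set X]].

Definition prec a b := lmul a setT b.
Definition sprec a b := lmul b setT `<` lmul a setT.
Definition eqstar a b := lmul b units a.

Definition transverse S :=
  forall s1 s2, S s1 -> S s2 -> eqstar s1 s2 -> s1 = s2.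

Definition locally_bounded S := forall v, objects v ->
  ~ exists s : nat -> C, forall i, lmul v S (s i) /\ sprec (s i) (s i.+1).

Definition sharp S : set C :=
  [set x | exists s u, [/\ S s, units u, dom s = cod u & x = mul s u]] `|` units.

(* A nonempty finite path is given by its first letter and the list of the
   following ones; [consecutive R] says that R relates adjacent letters. *)
Fixpoint consecutive (R : C -> C -> Prop) s (p : seq C) : Prop :=
  if p is s' :: p' then R s s' /\ consecutive R s' p' else True.

Fixpoint path_mul s (p : seq C) : C :=
  if p is s' :: p' then mul s (path_mul s' p') else s.

Definition normal_path S s (p : seq C) :=
  [/\ List.Forall (sharp S) (s :: p),
      consecutive (fun s1 s2 => dom s1 = cod s2) s p
    & consecutive (fun s1 s2 =>
        forall r, S r -> prec r (mul s1 s2) -> prec r s1) s p].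

Definition closed_right_comultiples S := forall r s a, S r -> S s ->
  prec r a -> prec s a -> exists t, [/\ S t, prec r t, prec s t & prec t a].

Definition generates A := forall B : set C, A `<=` B ->
  (forall x y, B x -> B y -> dom x = cod y -> B (mul x y)) -> B = setT.

Definition right_divisor a b := exists2 c, dom c = cod a & b = mul c a.

Definition garside S := [/\ closed_right_comultiples S,
  generates (S `|` units),
  forall a b, sharp S b -> right_divisor a b -> sharp S a
& forall a, exists s p, normal_path S s p /\ a = path_mul s p].

(* [is_head S a h] : h = H(a). *)
Definition is_head S a h :=
  [/\ S h, prec h a & forall r, S r -> prec r a -> prec r h].

Definition lim_candidates S (s : nat -> C) : set C :=
  [set r | (S `|` objects) r /\ \forall i \near \oo, prec r (s i)].

(* lim_i s_i = l. Limits are only considered for sequences along which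
   "r is a left divisor of s_i" is eventually true or eventually false, for
   each r. Without this a sequence alternating between x and y would have as
   limits the maximal common left divisors of x and y. *)
Definition is_lim S (s : nat -> C) l :=
  [/\ forall r, (S `|` objects) r ->
        (\forall i \near \oo, prec r (s i)) \/
        (\forall i \near \oo, ~ prec r (s i)),
      lim_candidates S s l
    & forall r, lim_candidates S s r -> prec l r -> prec r l].

Definition admissible S (T D : set C) := forall t, T t ->
  (exists2 t', T t' & normal_path S t [:: t']) \/ D (dom t).

Definition H_invariant S (T D : set C) := forall a x, ~ units a ->
  (T `|` D) x -> dom a = cod x -> exists2 h, is_head S (mul a x) h & T h.

(* The limit may be an object as well as an element of S. *)
Definition max_closed S (T D : set C) := forall t : nat -> C,
  (forall i, T (t i)) -> forall l, is_lim S t l -> (T `|` D) l.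

(* D is a union of isomorphism classes of objects. [H_invariant] only
   multiplies by noninvertible elements, so it does not give this, while the
   objects attached to an invariant subset of [Omega] always have it. If
   isomorphic objects of C are equal (e.g. for monoids and higher rank
   graphs), this holds for every set of objects. *)
Definition iso_closed (D : set C) := forall u, units u -> D (dom u) -> D (cod u).

Definition good_pairs S : set (set C * set C) := [set TD |
  [/\ TD.1 `<=` S /\ TD.2 `<=` objects,
      admissible S TD.1 TD.2,
      H_invariant S TD.1 TD.2,
      max_closed S TD.1 TD.2
    & iso_closed TD.2]].

End Category.

(* Main.v *)
From mathcomp Require Import all_boot.
From mathcomp Require Import all_classical.
From mathcomp Require Import topology.
Require Import Defs.

(** A character in [Omega] is determined by the set of those [c] for which it
    takes the value 1 on the principal right ideal of [c]. By finite alignment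
    every element of [J] is a finite union of principal right ideals, and the
    sets that arise in this way are exactly the nonempty, downward closed,
    directed sets for divisibility, called order ideals below. An order ideal
    stands for a finite or infinite path: it consists of the left divisors of
    the initial pieces of the path. In these terms closedness and invariance
    of a subset of [Omega] become elementary: [closed_family] ([family_of] and
    the lemmas about it).

    The Garside family enters through the label of an order ideal [F], its
    largest element in [letters], that is, in [S] or among the identities. The
    label exists because [S] is closed under right comultiples and locally
    bounded, and it is unique because [S] is transverse. It is the first
    letter of the path, or the vertex at which a constant path sits. The main
    property ([sharp_prec_mul], [label_push]) is that the label of [push a F]
    only depends on [a] and on the label of [F].

    A closed invariant family [X] is sent to the set [labels X] of its labels,
    and a set [Q] of labels to the family [paths Q] of all order ideals whose
    tails have their label in [Q]. The pair is recovered from a set of labels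
    by intersecting it with [S] and with the objects.

    - [paths (labels X) = X]: whether [c] divides the path of [F] depends on
      finitely many letters of that path, by induction on the number of
      generators in [c] ([decides_exists]). So if [a] is a long enough initial
      piece of [F], and [G] in [X] has the same label as the tail of [F] at
      [a], then [push a G] is close to [F]; as [X] is closed, it contains [F].
    - [labels (paths Q) = Q] for the pairs in question: admissibility allows
      one to continue any letter of [Q] to a normal path with letters in [Q],
      and normality says that its first letter is its label. The tails of that
      path at elements other than products of its letters are handled by
      H-invariance, and by closedness of the set of objects under isomorphism
      ([paths_cofinal]).
    - [labels X] satisfies the conditions on pairs: the nontrivial one is
      closedness under limits, for which ideals in [X] that realize the labels
      of a convergent sequence are made to converge along an ultrafilter.
    - [paths Q] is closed: labels of approximations of [F] converge to the
      label of [F] ([paths_label_limit]); this uses that the category is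
      countable. *)

Set Implicit Arguments.
Unset Strict Implicit.
Unset Printing Implicit Defensive.

Local Open Scope classical_set_scope.

(** * Divisibility and order ideals *)

Section Divisibility.
Context {C : smallCategory}.
Implicit Types (a b c u v x y z : C) (F G : set C).

Lemma precP a b : prec a b <-> exists2 x, dom a = cod x & b = mul a x.
Proof.
split=> [[x [_ ax] <-]|[x ax ->]]; first by exists x.
by exists x => //; split.
Qed.

Lemma prec_mulr a x : dom a = cod x -> prec a (mul a x).
Proof. by move=> ax; apply/precP; exists x. Qed.

Lemma prec_refl a : prec a a.
Proof. by apply/precP; exists (dom a); rewrite ?cod_dom ?mul_id. Qed.

Lemma prec_trans b a c : prec a b -> prec b c -> prec a c.
Proof.
move=> /precP[x ax ->] /precP[y]; rewrite (dom_mul ax) => xy ->.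
by apply/precP; exists (mul x y); rewrite ?cod_mul ?mulA.
Qed.

Lemma prec_cod a b : prec a b -> cod b = cod a.
Proof. by move=> /precP[x ax ->]; rewrite cod_mul. Qed.

Lemma cod_prec a : prec (cod a) a.
Proof. by apply/precP; exists a; rewrite ?dom_cod ?id_mul. Qed.

Lemma prec_mul2l a x y : dom a = cod x -> prec x y -> prec (mul a x) (mul a y).
Proof.
move=> ax /precP[z xz ->]; apply/precP.
by exists z; rewrite ?dom_mul ?mulA.
Qed.

Lemma objectsE v : objects v -> cod v = v.
Proof. by rewrite /objects /= => <-; rewrite cod_dom. Qed.

Lemma objects_cod a : objects (cod a).
Proof. exact: dom_cod. Qed.

Lemma objects_dom a : objects (dom a).
Proof. exact: dom_dom. Qed.

Lemma objects_prec v a : objects v -> prec v a <-> v = cod a.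
Proof.
move=> /objectsE ov; split=> [/prec_cod|->]; last exact: cod_prec.
by rewrite ov.
Qed.

Lemma units_objects v : objects v -> units v.
Proof.
move=> ov; exists v; rewrite (objectsE ov); have ovd : dom v = v := ov.
by split=> //; rewrite -{2}ovd mul_id ?ovd.
Qed.

Lemma unitsM u v : dom u = cod v -> units u -> units v -> units (mul u v).
Proof.
move=> uv [u' [u1 u2 u3 u4]] [v' [v1 v2 v3 v4]].
have v'u' : dom v' = cod u' by rewrite v2 -uv u1.
exists (mul v' u').
rewrite !dom_mul // !cod_mul //; split=> //.
- rewrite mulA ?dom_mul ?cod_mul // -(mulA uv v1) v3 -uv.
  by rewrite mul_id.
- by rewrite -mulA ?cod_mul // (mulA u2 uv) u4 uv id_mul v4.
Qed.

Hypothesis lc : left_cancellative C.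

Lemma prec_cancel a x y :
  dom a = cod x -> dom a = cod y -> prec (mul a x) (mul a y) -> prec x y.
Proof.
move=> ax ay /precP[z]; rewrite (dom_mul ax) => xz; rewrite -mulA // => e.
by apply/precP; exists z => //; apply: lc e; rewrite ?cod_mul.
Qed.

(** In a left cancellative category a right inverse is two-sided, so left
    divisors of invertible elements are invertible. *)
Lemma units_prec x u : prec x u -> units u -> units x.
Proof.
move=> /precP[y xy ->] [w []]; rewrite dom_mul // cod_mul // => yw wx e _.
have xyw : mul x (mul y w) = cod x by rewrite mulA.
have cyw : cod (mul y w) = cod y by rewrite cod_mul.
have dyw : dom (mul y w) = cod x by rewrite dom_mul.
exists (mul y w); rewrite cyw; split=> //.
apply: (@lc x); rewrite ?cod_dom ?cod_mul ?cyw //.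
by rewrite mulA ?cyw // xyw id_mul mul_id.
Qed.

Lemma units_mull u x : dom u = cod x -> units (mul u x) -> units u.
Proof. by move=> ux; apply: units_prec; exact: prec_mulr. Qed.

Lemma units_mulr u x : dom u = cod x -> units (mul u x) -> units x.
Proof.
move=> ux uux; have [w [uw wu uE wE]] := units_mull ux uux.
have -> : x = mul w (mul u x) by rewrite mulA // wE ux id_mul.
by apply: unitsM => //; [rewrite cod_mul | exists u; rewrite uE wE uw wu].
Qed.

Lemma prec_anti a b : prec a b -> prec b a -> eqstar a b.
Proof.
move=> /precP[y ay bE] /precP[x bx aE].
have xy : dom x = cod y by rewrite -ay aE dom_mul.
exists x => //; split=> //; apply: (units_mull xy).
have <- : dom b = mul x y.
  by apply: (@lc b); rewrite ?cod_dom ?cod_mul // mul_id mulA // -aE.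
exact/units_objects/objects_dom.
Qed.

(** The order ideal of the finite path [x]. *)
Definition below x : set C := [set c | prec c x].

(** In a countable category these are the sets of left divisors of finite and
    infinite paths. Under finite alignment they are in bijection with [Omega];
    see [char_of_Omega] and [ideal_of_ideal]. *)
Definition order_ideal F := [/\ exists a, F a,
  forall a b, prec a b -> F b -> F a
& forall a b, F a -> F b -> exists c, [/\ F c, prec a c & prec b c]].

(** The path of [F] with its initial piece [a] removed. *)
Definition shift a F : set C := [set x | dom a = cod x /\ F (mul a x)].

(** The path of [F] preceded by [b]. *)
Definition push b F : set C :=
  [set c | exists x, [/\ F x, dom b = cod x & prec c (mul b x)]].

Lemma order_ideal_cod F a b : order_ideal F -> F a -> F b -> cod a = cod b.
Proof.
move=> [_ _ d] Fa Fb; have [c [_ ac bc]] := d _ _ Fa Fb.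
by rewrite -(prec_cod ac) (prec_cod bc).
Qed.

Lemma below_ideal x : order_ideal (below x).
Proof.
split; first by exists x; exact: prec_refl.
- by move=> a b ab bx; exact: prec_trans ab bx.
- by move=> a b ax bx; exists x; split=> //; exact: prec_refl.
Qed.

Lemma shift_ideal a F : order_ideal F -> F a -> order_ideal (shift a F).
Proof.
move=> [ne dc di] Fa; split.
- by exists (dom a); split; rewrite ?cod_dom ?mul_id.
- move=> x y xy [ay Fay].
  have ax : dom a = cod x by rewrite ay (prec_cod xy).
  by split=> //; apply: dc Fay; exact: prec_mul2l.
- move=> x y [ax Fax] [ay Fay].
  have [c [Fc xc yc]] := di _ _ Fax Fay.
  have /precP[z az e] : prec a c by apply: prec_trans xc; exact: prec_mulr.
  subst c; exists z; split=> //; exact: prec_cancel xc || exact: prec_cancel yc.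
Qed.

Lemma push_ideal b F : order_ideal F -> (exists2 x, F x & dom b = cod x) ->
  order_ideal (push b F).
Proof.
move=> [ne dc di] [x Fx bx]; split.
- by exists (mul b x), x; split=> //; exact: prec_refl.
- move=> c d cd [y [Fy by_ dy]]; exists y; split=> //; exact: prec_trans dy.
- move=> c d [y [Fy by_ cy]] [z [Fz bz dz]].
  have [w [Fw yw zw]] := di _ _ Fy Fz.
  have bw : dom b = cod w by rewrite (prec_cod yw).
  exists (mul b w); split; first by exists w; split=> //; exact: prec_refl.
  + by apply: prec_trans cy _; exact: prec_mul2l.
  + by apply: prec_trans dz _; exact: prec_mul2l.
Qed.

Lemma push_mul b F x : F x -> dom b = cod x -> push b F (mul b x).
Proof. by move=> Fx bx; exists x; split=> //; exact: prec_refl. Qed.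

Lemma shift_push b F : order_ideal F -> (exists2 x, F x & dom b = cod x) ->
  shift b (push b F) = F.
Proof.
move=> oF [x Fx bx]; have [_ dc _] := oF; apply/seteqP; split=> y.
  move=> [by_ [z [Fz bz yz]]]; apply: dc Fz.
  exact: prec_cancel yz.
move=> Fy; have by_ : dom b = cod y by rewrite bx (order_ideal_cod oF Fx Fy).
by split=> //; exact: push_mul.
Qed.

Lemma push_shift a F : order_ideal F -> F a -> push a (shift a F) = F.
Proof.
move=> oF Fa; have [_ dc di] := oF; apply/seteqP; split=> y.
  by move=> [z [[az Faz] _ yz]]; exact: dc yz Faz.
move=> Fy; have [c [Fc /precP[z az e] yc]] := di _ _ Fa Fy.
by exists z; rewrite -e; split=> //; split=> //; rewrite -e.
Qed.

Lemma shift_shift a b F : dom a = cod b ->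
  shift b (shift a F) = shift (mul a b) F.
Proof.
move=> ab; apply/seteqP; split=> y.
  by move=> [by_ [_]]; rewrite mulA // => Fy; split=> //; rewrite dom_mul.
move=> [+ Fy]; rewrite dom_mul // => by_; split=> //; split.
  by rewrite cod_mul.
by rewrite mulA.
Qed.

Lemma push_push a b F : dom a = cod b ->
  push a (push b F) = push (mul a b) F.
Proof.
move=> ab; apply/seteqP; split=> y.
  move=> [c [[x [Fx bx cx]] ac yc]]; exists x; rewrite dom_mul //; split=> //.
  by apply: prec_trans yc _; rewrite -mulA //; exact: prec_mul2l.
move=> [x [Fx]]; rewrite dom_mul // => bx yx; exists (mul b x).
by rewrite cod_mul // mulA //; split=> //; exact: push_mul.
Qed.

Lemma shift_object v F : order_ideal F -> objects v -> F v -> shift v F = F.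
Proof.
move=> oF ov Fv; have dv : dom v = v := ov; have [_ _ di] := oF.
apply/seteqP; split=> y; first by move=> [vy]; rewrite -dv vy id_mul.
move=> Fy; have vy : dom v = cod y.
  by rewrite dv -(order_ideal_cod oF Fv Fy) (objectsE ov).
by split=> //; rewrite -dv vy id_mul.
Qed.

Lemma push_object v F : order_ideal F -> objects v -> F v -> push v F = F.
Proof. by move=> oF ov Fv; rewrite -{1}(shift_object oF ov Fv) push_shift. Qed.

End Divisibility.

(** * Labels of order ideals *)

Section Labels.
Context {C : smallCategory} (lc : left_cancellative C) {S : set C}.
Hypotheses (gS : garside S) (SU : S `&` @units C = set0).
Hypotheses (trS : transverse S) (lbS : locally_bounded S).
Implicit Types (a b c u v x y z h k r : C) (F G : set C).

Lemma S_nonunit s : S s -> ~ units s.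
Proof. by move=> Ss us; have : set0 s by rewrite -SU. Qed.

Lemma S_nonobject s : S s -> ~ objects s.
Proof. by move=> Ss /units_objects; exact: S_nonunit. Qed.

Lemma sharp_S s : S s -> sharp S s.
Proof.
move=> Ss; left; exists s, (dom s); rewrite cod_dom mul_id; split=> //.
exact/units_objects/objects_dom.
Qed.

Lemma sharp_right_divisor a b : dom a = cod b -> sharp S (mul a b) -> sharp S b.
Proof. by case: gS => _ _ rd _ ab /rd; apply; exists a. Qed.

(** Letters of paths, and objects at which paths stop. *)
Definition letters : set C := S `|` @objects C.

Lemma sharp_letters r : letters r -> sharp S r.
Proof. by case=> [/sharp_S//|/units_objects ur]; right. Qed.

Lemma sharpP h : sharp S h -> exists k, [/\ letters k, prec h k & prec k h].
Proof.
case=> [[s [u [Ss [w [uw wu uE wE]] su ->]]]|[w [hw wh hE _]]].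
  exists s; split; [by left | | exact: prec_mulr].
  apply/precP; exists w; rewrite ?dom_mul //.
  by rewrite -mulA // uE -su mul_id.
exists (cod h); split; [by right; exact: objects_cod| | exact: cod_prec].
by apply/precP; exists w; rewrite ?hE.
Qed.

(** Transversality gives this inside [S]; a letter of [S] cannot be equivalent
    to an identity since it is not invertible. *)
Lemma letters_anti h k : letters h -> letters k -> prec h k -> prec k h -> h = k.
Proof.
case=> [Sh|oh] [Sk|ok] hk kh.
- by apply: trS => //; exact: prec_anti.
- case: (S_nonunit Sh); apply: (units_prec lc hk); exact: units_objects.
- case: (S_nonunit Sk); apply: (units_prec lc kh); exact: units_objects.
- by rewrite (objects_prec _ oh) (objectsE ok) in hk.
Qed.

(** If [h] divides [a * y], only the first letter of [y] matters. When [a] is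
    a letter, this comes from a common right multiple of [a] and [h] inside
    [S]; the general case follows letter by letter. *)
Lemma sharp_prec_mul a h y : sharp S h -> dom a = cod y -> prec h (mul a y) ->
  exists k, [/\ sharp S k, prec k y, dom a = cod k & prec h (mul a k)].
Proof.
pose B : set C := [set a | forall h y, sharp S h -> dom a = cod y ->
  prec h (mul a y) ->
  exists k, [/\ sharp S k, prec k y, dom a = cod k & prec h (mul a k)]].
have [cm gen _ _] := gS.
suff BT : B = setT by have : B a by [rewrite BT]; exact.
apply: gen => [{}a [Sa|[w [aw wa aE wE]]] {}h {}y sh ay hay|].
- have [k [[Sk|ok] hk kh]] := sharpP sh; last first.
    exists (dom a); rewrite cod_dom mul_id; split=> //.
      + exact/sharp_letters/or_intror/objects_dom.
      + by rewrite ay; exact: cod_prec.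
      + apply: prec_trans hk _; apply/objects_prec => //.
        by rewrite -(cod_mul ay) (prec_cod (prec_trans kh hay)) (objectsE ok).
  have [t [St kt /precP[x ax tE] tay]] :=
    cm _ _ _ Sk Sa (prec_trans kh hay) (prec_mulr ay).
  exists x; split => //; last by rewrite -tE; exact: prec_trans kt.
  + by apply: (sharp_right_divisor ax); rewrite -tE; exact: sharp_S.
  + by apply: (prec_cancel lc ax ay); rewrite -tE.
- have wh : dom w = cod h by rewrite wa -(prec_cod hay) cod_mul.
  have awh : mul a (mul w h) = h by rewrite mulA // aE -wa wh id_mul.
  have cwh : dom a = cod (mul w h) by rewrite cod_mul.
  exists (mul w h); rewrite awh; split=> //; last exact: prec_refl.
    by apply: (sharp_right_divisor cwh); rewrite awh.
  by apply: (prec_cancel lc cwh ay); rewrite awh.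
- move=> {a h y} a b Ba Bb ab h y sh; rewrite dom_mul // => by_ hy.
  have aby : dom a = cod (mul b y) by rewrite cod_mul.
  have hy' : prec h (mul a (mul b y)) by rewrite mulA.
  have [k [sk ky ak hk]] := Ba _ _ sh aby hy'.
  have [l [sl ly bl kl]] := Bb _ _ sk by_ ky.
  exists l; split=> //.
  rewrite -mulA //; apply: prec_trans hk _; exact: prec_mul2l.
Qed.

(** In a product of a unit and an element of [S] the unit can be moved to the
    right, as [sharp S] is closed under right divisors. *)
Lemma nonunit_prec a : ~ units a -> exists2 s, S s & prec s a.
Proof.
pose B : set C := [set a | units a \/ exists2 s, S s & prec s a].
have [_ gen _ _] := gS.
suff BT : B = setT by have [] : B a by rewrite BT.
apply: gen => [{}a [Sa|ua]|{}a b Ba Bb ab]; [|by left|].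
  by right; exists a => //; exact: prec_refl.
case: Ba => [ua|[s Ss sa]]; last first.
  right; exists s => //; apply: prec_trans sa _; exact: prec_mulr.
case: Bb => [ub|[s Ss sb]]; first by left; exact: unitsM.
right; have as_ : dom a = cod s by rewrite ab (prec_cod sb).
have [w [aw wa aE wE]] := ua.
have sas : sharp S (mul a s).
  have was : dom w = cod (mul a s) by rewrite cod_mul.
  apply: (sharp_right_divisor was).
  rewrite mulA // wE as_ id_mul; exact: sharp_S.
have [k [[Sk|ok] ask kas]] := sharpP sas.
  by exists k => //; apply: prec_trans kas _; exact: prec_mul2l.
case: (S_nonunit Ss); apply: (units_mulr lc as_).
apply: (units_prec lc ask); exact: units_objects.
Qed.

(** The first letter of the path of [F], or its vertex if the path is
    constant. *)
Definition is_label F h :=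
  [/\ letters h, F h & forall r, letters r -> F r -> prec r h].

Lemma label_unique F h k : is_label F h -> is_label F k -> h = k.
Proof. by move=> [lh Fh mh] [lk Fk mk]; apply: letters_anti; auto. Qed.

Lemma label_ext F G h : (forall r, letters r -> (F r <-> G r)) ->
  is_label F h <-> is_label G h.
Proof.
move=> FG; split=> -[lh Fh mh]; split=> //; do ?exact/FG.
- by move=> r lr /(FG _ lr); exact: mh.
- by move=> r lr /(FG _ lr); exact: mh.
Qed.

(** A letter of [F] that is not largest is strictly below another letter of
    [F], by closure under right comultiples; this cannot go on forever. *)
Lemma label_exists F : order_ideal F -> exists h, is_label F h.
Proof.
move=> oF; have [[a Fa] dc di] := oF.
have Fobj r : objects r -> F r -> r = cod a.
  by move=> ro Fr; rewrite -(objectsE ro); exact: order_ideal_cod oF _ _.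
case: (pselect (exists2 s, S s & F s)) => [[s0 Ss0 Fs0]|noS]; last first.
  exists (cod a); split; first by right; exact: objects_cod.
    exact: dc (cod_prec a) Fa.
  move=> r [Sr|ro] Fr; first by case: noS; exists r.
  by rewrite (Fobj r) //; exact: prec_refl.
apply: contrapT => nolabel.
have step s : exists t, S s -> F s -> [/\ S t, F t & sprec s t].
  case: (pselect (S s /\ F s)) => [[Ss Fs]|nSF]; last first.
    by exists s => ? ?; case: nSF.
  have [r [lr Fr nrs]] : exists r, [/\ letters r, F r & ~ prec r s].
    apply: contrapT => nr; apply: nolabel; exists s; split=> //; first by left.
    by move=> r lr Fr; apply: contrapT => nrs; apply: nr; exists r.
  case: lr => [Sr|ro]; last first.
    case: nrs; apply/objects_prec => //.
    by rewrite (Fobj _ ro Fr); exact: order_ideal_cod oF _ _.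
  have [c [Fc rc sc]] := di _ _ Fr Fs.
  have [cm _ _ _] := gS; have [t [St rt st tc]] := cm _ _ _ Sr Ss rc sc.
  exists t => _ _; split=> //; first exact: dc Fc.
  split=> [x tx|ts]; first exact: prec_trans st tx.
  by apply: nrs; apply: prec_trans rt _; apply: ts; exact: prec_refl.
have [next nextP] := choice step.
pose s n := iter n next s0.
have sP n : S (s n) /\ F (s n).
  by elim: n => [//|n [Sn Fn]]; have [] := nextP _ Sn Fn.
apply: (lbS (objects_cod a)); exists s => n; have [Sn Fn] := sP n.
split; last by have [] := nextP _ Sn Fn.
have e : cod (s n) = cod a by exact: order_ideal_cod oF _ _.
by exists (s n); rewrite -e ?dom_cod ?id_mul.
Qed.

Lemma label_nonunit F h a : is_label F h -> order_ideal F -> F a -> ~ units a ->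
  S h.
Proof.
move=> [[//|oh] Fh mh] [_ dc _] Fa /nonunit_prec[s Ss sa].
have sh : prec s h by apply: mh; [left|exact: dc Fa].
by case: (S_nonunit Ss); apply: (units_prec lc sh); exact: units_objects.
Qed.

(** By [sharp_prec_mul] a letter divides [b y], with [y] in [F], only if it
    divides [b p]; so the path of [F] may be replaced by its first letter. *)
Lemma label_push F p b h : order_ideal F -> is_label F p -> dom b = cod p ->
  is_label (push b F) h <-> is_label (below (mul b p)) h.
Proof.
move=> oF [lp Fp mp] bp; have [_ dc _] := oF; apply: label_ext => r lr; split.
  move=> [y [Fy by_ ry]].
  have [k [sk ky bk rk]] := sharp_prec_mul (sharp_letters lr) by_ ry.
  have [l [ll kl lk]] := sharpP sk.
  apply: prec_trans rk _; apply: prec_mul2l => //; apply: prec_trans kl _.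
  by apply: mp => //; apply: dc Fy; exact: prec_trans ky.
by exists p.
Qed.

(** For noninvertible [x], the label of the finite path [x] is [H(x)]. *)
Lemma is_headP x h : ~ units x -> is_head S x h <-> is_label (below x) h.
Proof.
move=> nx; split=> [[Sh hx mh]|lh]; last first.
  have Sh := label_nonunit lh (below_ideal x) (prec_refl x) nx.
  by case: lh => _ hx mh; split=> // r Sr rx; apply: mh => //; left.
split=> //; first by left.
move=> r [Sr|ro] rx; first exact: mh.
by apply/objects_prec => //; rewrite -(prec_cod hx); exact/objects_prec.
Qed.

End Labels.

(** * Families of order ideals and sets of labels *)

Lemma In_mem (T : Type) (s : seq T) (x : T) :
  List.In x s <-> (x : {classic T}) \in (s : seq {classic T}).
Proof.
elim: s => [|y s IHs] //=; rewrite in_cons.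
by split=> [[->|/IHs->]|/orP[/eqP->|/IHs]];
  [rewrite eqxx | rewrite orbT | left | right].
Qed.

Lemma finite_set_list (T : Type) (A : set T) :
  finite_set A -> exists l : seq T, forall x, A x <-> List.In x l.
Proof.
move=> fA; have /finite_seqP[s ->] : finite_set (A : set {classic T}) by [].
by exists s => x; rewrite In_mem.
Qed.

Lemma ultra_list (I T : Type) (U : set_system I) (l : seq T) (P : T -> set I) :
  UltraFilter U -> U [set i | exists2 c, List.In c l & P c i] ->
  exists2 c, List.In c l & U (P c).
Proof.
move=> UU; elim: l => [|c l IHl] Ul.
  by have [i [? []]] := filter_ex Ul.
have [Uc|Uc] := in_ultra_setVsetC (P c) UU; first by exists c => //; left.
have [|d dl Ud] := IHl; last by exists d => //; right.
apply: filterS (filterI Ul Uc) => i [[d [<-|dl] Pd] nPc] //.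
by exists d.
Qed.

Section Alignment.
Context {C : smallCategory} (lc : left_cancellative C) (fa : finitely_aligned C).
Implicit Types (a b c x : C).

Lemma aligned_list a b : exists l : seq C, forall x,
  (prec a x /\ prec b x) <-> exists2 c, List.In c l & prec c x.
Proof.
have [K /finite_set_list[l Kl] ab] := fa a b; exists l => x.
have -> : (prec a x /\ prec b x) = (lmul a setT `&` lmul b setT) x by [].
by rewrite ab; split=> -[c /Kl cl cx]; exists c => //; exact/Kl.
Qed.

(** Finite alignment makes the existence of common multiples inside an order
    ideal a property that passes to pointwise limits. *)
Lemma ultralimit_ideal (I : Type) (U : set_system I) (F : I -> set C) :
  UltraFilter U -> (forall i, order_ideal (F i)) ->
  (exists a, U [set i | F i a]) -> order_ideal [set a | U [set i | F i a]].
Proof.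
move=> UU oF [a0 Ua0]; split; first by exists a0.
- move=> a b ab /= Ub; apply: filterS Ub => i Fb.
  by have [_ dc _] := oF i; exact: dc Fb.
- move=> a b /= Ua Ub; have [l lP] := aligned_list a b.
  have [c cl Uc] : exists2 c, List.In c l & U [set i | F i c].
    apply: ultra_list; apply: filterS (filterI Ua Ub) => i [Fa Fb] /=.
    have [_ dc di] := oF i; have [x [Fx ax bx]] := di _ _ Fa Fb.
    have /lP[c cl cx] := conj ax bx.
    by exists c => //; exact: dc Fx.
  have [|? ?] := (lP c).2; first by exists c => //; exact: prec_refl.
  by exists c.
Qed.

End Alignment.

Section Families.
Context {C : smallCategory} (lc : left_cancellative C).
Implicit Types (a b c x : C) (F G : set C) (X : set (set C)).

Definition agree_on (l : seq C) F G := forall c, List.In c l -> (G c <-> F c).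

(** Closed invariant subsets of the unit space, seen as sets of order ideals:
    [push b (shift a F)] is the image of [F] under the partial bijection
    [a x |-> b x]. *)
Definition closed_family X := [/\ X `<=` @order_ideal C,
  forall F, order_ideal F ->
    (forall l, exists2 G, X G & agree_on l F G) -> X F
& forall F a b, X F -> F a -> dom a = dom b -> X (push b (shift a F))].

Lemma family_shift X F a : closed_family X -> X F -> F a -> X (shift a F).
Proof.
move=> [XI _ inv] XF Fa.
have oG := shift_ideal lc (XI _ XF) Fa.
rewrite -(push_object oG (objects_dom a)); last first.
  by split; rewrite ?cod_dom ?mul_id.
by apply: inv => //; rewrite dom_dom.
Qed.

Lemma family_push X F b x : closed_family X -> X F -> F x -> dom b = cod x ->
  X (push b F).
Proof.
move=> [XI _ inv] XF Fx bx; have [_ dc _] := XI _ XF.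
have Fv : F (cod x) by apply: dc Fx; exact: cod_prec.
rewrite -(shift_object (XI _ XF) (objects_cod x) Fv).
by apply: inv => //; rewrite dom_cod.
Qed.

End Families.

Section Correspondence.
Context {C : smallCategory} (lc : left_cancellative C) {S : set C}.
Hypotheses (gS : garside S) (SU : S `&` @units C = set0).
Hypotheses (trS : transverse S) (lbS : locally_bounded S).
Implicit Types (a b c u v x y z h k r p : C) (F G : set C) (X : set (set C)).
Implicit Types (Q T D : set C).

Let lunique := label_unique lc SU trS.
Let lexists := label_exists gS lbS.
Let lpush := label_push lc gS.

Definition labels X : set C := [set h | exists2 F, X F & is_label (S := S) F h].

(** Tails at all elements of [F] are considered, and not only those at products
    of letters, so that [paths Q] is stable under passing to tails. *)
Definition paths Q : set (set C) := [set F | order_ideal F /\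
  forall a h, F a -> is_label (S := S) (shift a F) h -> Q h].

Lemma label_push_eq F G p b h : order_ideal F -> order_ideal G ->
  is_label (S := S) F p -> is_label (S := S) G p -> dom b = cod p ->
  is_label (S := S) (push b F) h -> is_label (S := S) (push b G) h.
Proof.
by move=> oF oG lF lG bp /(lpush _ oF lF bp) ?; apply/(lpush _ oG lG bp).
Qed.

(** The label of a tail is determined by any later piece of the path together
    with the letter that follows it, by [label_push]. *)
Lemma same_label_prec a b F G p : order_ideal F -> order_ideal G ->
  F b -> G b -> prec a b ->
  is_label (S := S) (shift b F) p -> is_label (S := S) (shift b G) p ->
  exists2 q, is_label (S := S) (shift a F) q & is_label (S := S) (shift a G) q.
Proof.
move=> oF oG Fb Gb /precP[x ax bE]; subst b.
have [[_ dcF _] [_ dcG _]] := (oF, oG); rewrite -!shift_shift // => lF lG.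
have Fa : F a by apply: dcF Fb; exact: prec_mulr.
have Ga : G a by apply: dcG Gb; exact: prec_mulr.
have [oFa oGa] := (shift_ideal lc oF Fa, shift_ideal lc oG Ga).
have Fx : shift a F x by [].
have Gx : shift a G x by [].
have [q lq] := lexists oFa; exists q => //.
have xp : dom x = cod p by have [_ []] := lF.
rewrite -(push_shift oGa Gx); rewrite -(push_shift oFa Fx) in lq.
exact: label_push_eq (shift_ideal lc oFa Fx) (shift_ideal lc oGa Gx) lF lG xp lq.
Qed.

(** The piece [a] of the path of [F], together with the next letter, already
    shows that [c] is not in [F] when this is the case. *)
Definition decides a F c := forall G p, order_ideal G -> G a ->
  is_label (S := S) (shift a F) p -> is_label (S := S) (shift a G) p ->
  G c -> F c.

Lemma decides_prec a b F c : order_ideal F -> F b -> prec a b ->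
  decides a F c -> decides b F c.
Proof.
move=> oF Fb ab dec G p oG Gb lF lG; have [_ dcG _] := oG.
have [q qF qG] := same_label_prec oF oG Fb Gb ab lF lG.
by apply: (dec G q) => //; exact: dcG Gb.
Qed.

(** A product of [n] generators divides a path only if it divides the product
    of the first [n] letters of that path. In the
    induction over generators, once [c] is known to be in [F], testing [c * d]
    against [F] amounts to testing [d] against the tail of [F] at [c]. *)
Lemma decides_exists F c : order_ideal F -> exists2 a, F a & decides a F c.
Proof.
pose B : set C := [set c | forall F, order_ideal F ->
  exists2 a, F a & decides a F c].
have [_ gen _ _] := gS.
suff BT : B = setT by have : B c by [rewrite BT]; apply.
apply: gen => [{F}{}c Sc F oF|{F}c d Bc Bd cd F oF].
  have [[a Fa] dc _] := oF; have Fv := dc _ _ (cod_prec a) Fa.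
  exists (cod a) => // G p oG Gv.
  rewrite !shift_object //; try exact: objects_cod.
  move=> [lp Fp mp] [_ Gp mG] Gc.
  case: Sc => [Sc|uc]; first by apply: dc Fp; apply: mG => //; left.
  apply: dc Fv; have <- : cod c = cod a.
    by rewrite (order_ideal_cod oG Gc Gv) cod_cod.
  have [w [cw wc cE _]] := uc.
  by apply/precP; exists w; rewrite ?cE.
case: (pselect (F c)) => [Fc|nFc].
  have oFc := shift_ideal lc oF Fc.
  have [a [ca Fca] dec] := Bd _ oFc.
  exists (mul c a) => // G p oG Gca; rewrite -!shift_shift // => lF lG Gcd.
  have [_ dcG _] := oG.
  have Gc : G c by apply: dcG Gca; exact: prec_mulr.
  have oGc := shift_ideal lc oG Gc.
  have [//|//|//] := dec (shift c G) p oGc _ lF lG.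
have [a Fa dec] := Bc _ oF; exists a => // G p oG Ga lF lG Gcd.
have [_ dcG _] := oG.
by case: nFc; apply: (dec G p) => //; apply: dcG Gcd; exact: prec_mulr.
Qed.

Lemma decides_list F (l : seq C) : order_ideal F -> exists2 a, F a &
  forall G p, order_ideal G -> G a -> is_label (S := S) (shift a F) p ->
    is_label (S := S) (shift a G) p -> agree_on l F G.
Proof.
move=> oF; have [[a0 Fa0] dc di] := oF; elim: l => [|c l [a Fa IHa]].
  by exists a0.
have [b Fb decb] := decides_exists c oF.
have [d [Fd ad bd]] := di _ _ Fa Fb.
(* If [c] is in [F], it is made a divisor of [e], and hence belongs to every
   order ideal that contains [e]. *)
have [e [Fe de ce]] : exists e, [/\ F e, prec d e & F c -> prec c e].
  case: (pselect (F c)) => [Fc|nFc]; last by exists d; split=> //; exact: prec_refl.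
  by have [e [Fe de ce]] := di _ _ Fd Fc; exists e.
exists e => // G p oG Ge lF lG c' c'l; have [_ dcG _] := oG; split.
  suff : decides e F c' by apply; eauto.
  apply: (@decides_prec d) => //.
  case: c'l => [<-|c'l]; first exact: (@decides_prec b).
  apply: (@decides_prec a) => // G' p' oG' Ga' lF' lG'.
  by apply: (IHa _ _ oG' Ga' lF' lG' c' c'l).1.
case: c'l => [<- /ce cp|c'l]; first exact: dcG Ge.
have ae := prec_trans ad de.
have [q qF qG] := same_label_prec oF oG Fe Ge ae lF lG.
by apply: (IHa G q oG _ qF qG c' c'l).2; exact: dcG Ge.
Qed.

(** For [F] in [paths (labels X)] and an initial piece [a] of [F], some [G] in
    [X] has the same label as the tail of [F] at [a]. Then [push a G] is in
    [X], and it approximates [F] when [a] is long. *)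
Lemma paths_labels X : closed_family X -> paths (labels X) = X.
Proof.
move=> cX; have [XI cl _] := cX; apply/seteqP; split=> F; last first.
  move=> XF; split=> [|a h Fa lh]; first exact: XI.
  by exists (shift a F) => //; exact: family_shift.
move=> [oF FX]; apply: cl => // l.
have [a Fa aP] := decides_list l oF.
have oFa := shift_ideal lc oF Fa.
have [p lp] := lexists oFa; have [G XG lG] := FX _ _ Fa lp.
have [_ Gp _] := lG; have ap : dom a = cod p by have [_ []] := lp.
have Gne : exists2 x, G x & dom a = cod x by exists p.
exists (push a G); first exact: family_push Gp ap.
apply: (aP _ p) => //; first exact: push_ideal (XI _ XG) Gne.
  have [_ dc _] := push_ideal (XI _ XG) Gne.
  by apply: dc (push_mul Gp ap); exact: prec_mulr.
by rewrite (shift_push lc (XI _ XG) Gne).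
Qed.

(** * From closed invariant families to pairs *)

Lemma labels_split Q : Q `<=` letters (S := S) ->
  (Q `&` S) `|` (Q `&` @objects C) = Q.
Proof. by move=> QL; rewrite -setIUr; apply/setIidl. Qed.

Lemma labels_letters X : labels X `<=` letters (S := S).
Proof. by move=> h [F _ []]. Qed.

Lemma labels_admissible X : closed_family X ->
  admissible S (labels X `&` S) (labels X `&` @objects C).
Proof.
move=> cX t [[F XF lt] St]; have [XI _ _] := cX.
have [_ Ft mt] := lt.
have [x lx] := lexists (shift_ideal lc (XI _ XF) Ft).
have Lx : labels X x by exists (shift t F) => //; exact: family_shift.
have [[Sx|ox] [tx Ftx] _] := lx; last first.
  by right; rewrite tx (objectsE ox).
left; exists x => //; split.
- apply: List.Forall_cons; first exact: sharp_S.
  by apply: List.Forall_cons => //; exact: sharp_S.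
- by [].
(* The product [mul t x] is in [F], so letters dividing it are below [t]. *)
- split=> // r Sr rtx; apply: mt; first by left.
  by have [_ dc _] := XI _ XF; exact: dc Ftx.
Qed.

Lemma labels_H_invariant X : closed_family X ->
  H_invariant S (labels X `&` S) (labels X `&` @objects C).
Proof.
move=> cX a x na; rewrite labels_split; last exact: labels_letters.
move=> [F XF lx] ax; have [XI _ _] := cX; have [_ Fx _] := lx.
have oF := XI _ XF; have oaF : order_ideal (push a F).
  by apply: push_ideal => //; exists x.
have [h lh] := lexists oaF.
have hx := (lpush h oF lx ax).1 lh.
have nax : ~ units (mul a x) by move/(units_mull lc ax).
have hH := (is_headP lc gS SU _ nax).2 hx.
exists h => //; split; last by case: hH.
by exists (push a F) => //; exact: family_push Fx ax.
Qed.

(** The ideals realizing a convergent sequence of labels accumulate, along any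
    nonprincipal ultrafilter, at an ideal labelled by the limit. *)
Lemma labels_max_closed X : finitely_aligned C -> closed_family X ->
  max_closed S (labels X `&` S) (labels X `&` @objects C).
Proof.
move=> fa cX t tX l [dich [ll ltl] maxl].
rewrite labels_split; last exact: labels_letters.
have [XI cl _] := cX.
have /choice[F FP] : forall i, exists F, X F /\ is_label (S := S) F (t i).
  by move=> i; have [[F XF lF] _] := tX i; exists F.
have [U [UU oU]] : exists U, UltraFilter U /\ \oo `<=` U by exact: ultraFilterLemma.
have Ft r i : letters (S := S) r -> F i r <-> prec r (t i).
  move=> lr; have [/XI[_ dc _] [_ Fti mt]] := FP i.
  by split=> [|rt]; [exact: mt | exact: dc Fti].
pose G : set C := [set a | U [set i | F i a]].
have Gl : G l by apply: oU; apply: filterS ltl => i; exact: (Ft _ _ _).2.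
have oG : order_ideal G.
  by apply: ultralimit_ideal => // [i|]; [have [/XI] := FP i | exists l].
exists G.
  apply: cl => // s.
  have Us : U [set i | agree_on s G (F i)].
    elim: s => [|c s IHs]; first by apply: filterS filterT => i _ c [].
    have Uc : U [set i | F i c <-> G c].
      have [Gc|nGc] := pselect (G c).
        by apply: filterS (Gc) => i Fc; split.
      have [//|Unc] := in_ultra_setVsetC [set i | F i c] UU.
      by apply: filterS Unc => i nFc; split.
    by apply: filterS (filterI IHs Uc) => i [si ci] d [<-|/si].
  have [i ai] := filter_ex Us.
  by exists (F i) => //; have [] := FP i.
have Gr r : letters (S := S) r -> G r -> prec r l.
  move=> lr Gr; have [k lk] := lexists oG; have [lek Gk mk] := lk.
  have kl : prec k l.
    apply: maxl; last exact: mk.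
    split=> //; have [//|/oU nk] := dich k lek.
    have [i [Fk nFk]] := filter_ex (filterI Gk nk).
    by case: nFk; apply/Ft.
  by apply: prec_trans kl; exact: mk.
by split.
Qed.

Lemma unit_label u h : units u -> is_label (S := S) (below u) h -> h = cod u.
Proof.
move=> uu [[Sh|oh] hu _]; last by apply/objects_prec.
by case: (S_nonunit SU Sh); exact: (units_prec lc (hu : prec h u)).
Qed.

Lemma labels_iso_closed X : closed_family X -> iso_closed (labels X `&` @objects C).
Proof.
move=> cX u uu [[F XF lu] _]; have [XI _ _] := cX.
have ud : dom u = cod (dom u) by rewrite cod_dom.
have [_ Fu _] := lu; have oF := XI _ XF.
have [h lh] : exists h, is_label (S := S) (push u F) h.
  by apply: lexists; apply: push_ideal => //; exists (dom u).
have := (lpush h oF lu ud).1 lh; rewrite mul_id => /(unit_label uu) hE.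
split; last exact: objects_cod.
by exists (push u F); [exact: family_push Fu ud | rewrite -hE].
Qed.

Lemma labels_good X : finitely_aligned C -> closed_family X ->
  good_pairs S (labels X `&` S, labels X `&` @objects C).
Proof.
move=> fa cX; split=> /=.
- by split; exact: subIsetr.
- exact: labels_admissible.
- exact: labels_H_invariant.
- exact: labels_max_closed.
- exact: labels_iso_closed.
Qed.

(** * From pairs to closed invariant families *)

Section PathsOfPair.
Variables (T D : set C).
Hypotheses (TS : T `<=` S) (DO : D `<=` @objects C) (adm : admissible S T D).
Hypotheses (inv : H_invariant S T D) (mcl : max_closed S T D).
Hypothesis iso : iso_closed D.

Let Q := T `|` D.

Lemma pair_letters : Q `<=` letters (S := S).
Proof. by move=> h [/TS|/DO]; [left|right]. Qed.

(** H-invariance speaks of the finite path [a p]; by [label_push] it controls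
    all paths that continue [a] with a path of label [p]. *)
Lemma pair_push_nonunit F a p h : ~ units a -> order_ideal F ->
  is_label (S := S) F p -> Q p -> dom a = cod p ->
  is_label (S := S) (push a F) h -> Q h.
Proof.
move=> na oF lp Qp ap /(lpush _ oF lp ap) lh.
have [k kH Tk] := inv na Qp ap; left.
have nap : ~ units (mul a p) by move/(units_mull lc ap).
by rewrite (lunique lh ((is_headP lc gS SU _ nap).1 kH)).
Qed.

(** To control all labels of [G] it suffices to control those of tails of [G]
    that belong to a family [Y] stable under passing to later tails. Where the
    tail of [G] differs from one in [Y] by a noninvertible element,
    H-invariance applies. If they differ by an invertible element, a further
    letter makes the difference noninvertible, unless the tail is constant. *)
Lemma paths_cofinal (Y : set (set C)) :
  let cof G := forall b, G b ->
    exists y, [/\ dom b = cod y, G (mul b y) & Y (shift (mul b y) G)] in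
  (forall F, Y F -> [/\ order_ideal F, cof F &
    forall p, is_label (S := S) F p -> Q p]) ->
  forall G, order_ideal G -> cof G -> paths Q G.
Proof.
move=> cof YP G oG cG; split=> // b h Gb.
have [y [by_ Gby]] := cG _ Gb; rewrite -shift_shift // => YF.
have oGb := shift_ideal lc oG Gb; have Gy : shift b G y by [].
rewrite -{1}(push_shift oGb Gy).
set F := shift y (shift b G) in YF *.
have [oF cF QF] := YP _ YF; have [p lp] := lexists oF; have Qp := QF _ lp.
have yp : dom y = cod p by have [_ []] := lp.
have [uy|ny] := pselect (units y); last exact: pair_push_nonunit ny oF lp Qp yp.
have [Tp|Dp] := Qp; last first.
  have py : p = dom y by rewrite yp (objectsE (DO Dp)).
  move/(lpush _ oF lp yp); rewrite py mul_id => /(unit_label uy) ->.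
  by right; apply: iso => //; rewrite -py.
have [_ Fp _] := lp; have [z [pz Fpz YF']] := cF _ Fp.
have [oF' _ QF'] := YP _ YF'; have [q lq] := lexists oF'; have Qq := QF' _ lq.
have ypz : dom y = cod (mul p z) by rewrite cod_mul.
have pzq : dom (mul p z) = cod q by have [_ []] := lq.
rewrite -(push_shift oF Fpz) (push_push _ ypz).
apply: pair_push_nonunit oF' lq Qq _; last by rewrite dom_mul.
move=> /(units_mulr lc ypz)/(units_mull lc pz).
exact: (S_nonunit SU (TS Tp)).
Qed.

Lemma paths_shift F a : paths Q F -> F a -> paths Q (shift a F).
Proof.
move=> [oF FQ] Fa; split; first exact: shift_ideal.
move=> b h [ab Fab]; rewrite shift_shift //; exact: FQ.
Qed.

Lemma paths_cof F b : paths Q F -> F b -> exists y,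
  [/\ dom b = cod y, F (mul b y) & paths Q (shift (mul b y) F)].
Proof.
move=> PF Fb; exists (dom b); rewrite mul_id cod_dom; split=> //.
exact: paths_shift.
Qed.

Lemma paths_label F p : paths Q F -> is_label (S := S) F p -> Q p.
Proof.
move=> [oF FQ]; have [[a Fa] dc _] := oF.
have Fv : F (cod a) by apply: dc Fa; exact: cod_prec.
by have := FQ (cod a) p Fv; rewrite shift_object //; exact: objects_cod.
Qed.

Lemma paths_pushshift F a b : paths Q F -> F a -> dom a = dom b ->
  paths Q (push b (shift a F)).
Proof.
move=> PF Fa ab; have PG := paths_shift PF Fa; set G := shift a F in PG *.
have [oG _] := PG.
have Gb : G (dom b) by rewrite /G /shift /= -ab cod_dom mul_id.
have Gne : exists2 x, G x & dom b = cod x by exists (dom b); rewrite ?cod_dom.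
apply: (paths_cofinal (Y := paths Q)).
- move=> F' PF'; split; first by case: PF'.
    by move=> c; exact: paths_cof.
  by move=> p; exact: paths_label.
- exact: push_ideal.
- move=> c [x [Gx bx /precP[y cy e]]]; exists y; rewrite -e; split=> //.
    exact: push_mul.
  by rewrite -shift_shift // shift_push //; exact: paths_shift.
Qed.

Lemma countable_lists : countable [set: C] -> exists (f : C -> nat)
  (L : nat -> seq C), forall n c, (f c < n)%N -> List.In c (L n).
Proof.
move=> /countable_injP[f finj]; exists f.
suff /choice[L LP] : forall n, exists l, forall c, (f c < n)%N -> List.In c l.
  by exists L.
elim=> [|n [l lP]]; first by exists [::].
have [[d dn]|nd] := pselect (exists d, f d = n); last first.
  exists l => c; rewrite ltnS leq_eqVlt => /orP[/eqP cn|/lP//].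
  by case: nd; exists c.
exists (d :: l) => c; rewrite ltnS leq_eqVlt => /orP[/eqP cn|/lP]; last by right.
by left; apply: finj; rewrite ?inE // dn cn.
Qed.

(** If labels in [T] occur arbitrarily close to [F] then they form a sequence
    converging to the label of [F]; otherwise, close to [F] there are only
    constant paths, with the same label as [F]. *)
Lemma paths_label_limit F h : countable [set: C] -> order_ideal F ->
  (forall l, exists2 G, paths Q G & agree_on l F G) ->
  is_label (S := S) F h -> Q h.
Proof.
move=> /countable_lists[f [L fL]] oF apx lh; have [leh Fh mh] := lh.
have [near|] := pselect (forall n, exists t, T t /\ exists G,
    [/\ paths Q G, agree_on (L n) F G & is_label (S := S) G t]).
  have [t tP] := choice near.
  apply: (mcl (fun n => (tP n).1)).
  have tF r n : letters (S := S) r -> (f r < n)%N -> prec r (t n) <-> F r.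
    move=> lr rn; have [_ [G [[oG _] /(_ r (fL _ _ rn)) <- [_ Gt mt]]]] := tP n.
    have [_ dc _] := oG.
    by split=> [rt|]; [exact: dc Gt | exact: mt].
  split.
  - move=> r lr; have [Fr|nFr] := pselect (F r); [left|right];
    by exists (f r).+1 => // n /= rn; apply/tF.
  - by split=> //; exists (f h).+1 => // n /= rn; apply/tF.
  - move=> r [lr [N _ rN]] _; apply: mh => //.
    apply/(tF r (maxn N (f r).+1)) => //; first by rewrite leq_maxr.
    by apply: rN; rewrite /= leq_maxl.
move=> /existsNP[n nT]; have [G PG aG] := apx (h :: L n).
have [oG _] := PG; have [k lk] := lexists oG; have [lek Gk mk] := lk.
have Gh : G h by apply/(aG h) => //; left.
have hk := mk _ leh Gh.
case: (paths_label PG lk) => [Tk|Dk].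
  case: nT; exists k; split=> //; exists G; split=> // c cl.
  by apply: aG; right.
have ok := DO Dk; case: (leh) => [Sh|oh].
  by case: (S_nonunit SU Sh); apply: (units_prec lc hk); exact: units_objects.
by right; have := hk; rewrite (objects_prec _ oh) (objectsE ok) => ->.
Qed.

Lemma paths_family : countable [set: C] -> closed_family (paths Q).
Proof.
move=> cC; split; [by move=> F [] | | exact: paths_pushshift].
move=> F oF apx; split=> // a h Fa.
apply: (paths_label_limit cC (shift_ideal lc oF Fa)) => l.
(* Membership of [c] in the tail at [a] is membership of [mul a c] in [F]. *)
have [G PG aG] := apx (a :: [seq mul a c | c <- l]).
have Ga : G a by apply/(aG a) => //; left.
exists (shift a G); first exact: paths_shift.
move=> c cl; have eq : G (mul a c) <-> F (mul a c).
  by apply: aG; right; exact: List.in_map.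
by split=> -[ac /eq].
Qed.

(** A vertex label, or a letter whose domain is a vertex label, is followed by
    the constant path: this makes all paths infinite. *)
Lemma pair_next p : exists q, Q p -> [/\ Q q, dom p = cod q &
  forall r, letters (S := S) r -> prec r (mul p q) -> prec r p].
Proof.
have [Qp|nQ] := pselect (Q p); last by exists p.
have const : Q (dom p) -> exists q, Q p -> [/\ Q q, dom p = cod q &
    forall r, letters (S := S) r -> prec r (mul p q) -> prec r p].
  by exists (dom p); rewrite cod_dom mul_id.
case: Qp => [Tp|Dp]; last by apply: const; right; rewrite (DO Dp : dom p = p).
have [[q Tq [_ [pq _] [nf _]]]|Dp] := adm Tp; last by apply: const; right.
exists q => _; split=> //; first by left.
move=> r [Sr|ro]; first exact: nf.
by rewrite !objects_prec // cod_mul.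
Qed.

Section Realization.
Variable next : C -> C.
Hypothesis nextP : forall p, Q p -> [/\ Q (next p), dom p = cod (next p) &
  forall r, letters (S := S) r -> prec r (mul p (next p)) -> prec r p].

Fixpoint prefix m p : C :=
  if m is m'.+1 then mul p (prefix m' (next p)) else p.

Definition path_from p : set C := [set a | exists m, prec a (prefix m p)].

Lemma prefix_cod m p : Q p -> cod (prefix m p) = cod p.
Proof.
elim: m p => [//|m IHm] p /nextP[Qn pn _] /=.
by rewrite cod_mul // IHm.
Qed.

Lemma prefix_prec m p : Q p -> prec (prefix m p) (prefix m.+1 p).
Proof.
elim: m p => [|m IHm] p Qp; have [Qn pn _] := nextP Qp.
  exact: prec_mulr.
by apply: prec_mul2l; [rewrite prefix_cod | exact: IHm].
Qed.

Lemma prefix_mono m n p : Q p -> (m <= n)%N -> prec (prefix m p) (prefix n p).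
Proof.
move=> Qp; elim: n => [|n IHn].
  by rewrite leqn0 => /eqP->; exact: prec_refl.
rewrite leq_eqVlt => /orP[/eqP->|/IHn mn]; first exact: prec_refl.
by apply: prec_trans mn _; exact: prefix_prec.
Qed.

Lemma path_from_ideal p : Q p -> order_ideal (path_from p).
Proof.
move=> Qp; split; first by exists p, 0%N; exact: prec_refl.
- by move=> a b ab [m bm]; exists m; exact: prec_trans ab bm.
- move=> a b [m am] [n bn]; exists (prefix (maxn m n) p); split.
  + by exists (maxn m n); exact: prec_refl.
  + by apply: prec_trans am _; apply: prefix_mono => //; exact: leq_maxl.
  + by apply: prec_trans bn _; apply: prefix_mono => //; exact: leq_maxr.
Qed.

(** By [sharp_prec_mul] a letter [r] dividing [prefix m.+1 p] divides [p k] for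
    a letter [k] dividing the remaining path. By induction [k] divides
    [next p], and normality of [p, next p] gives that [r] divides [p]. *)
Lemma prefix_label m p r : Q p -> letters (S := S) r ->
  prec r (prefix m p) -> prec r p.
Proof.
elim: m p r => [//|m IHm] p r Qp lr rp; have [Qn pn nf] := nextP Qp.
have ppn : dom p = cod (prefix m (next p)) by rewrite prefix_cod.
have [k [sk kn pk rk]] := sharp_prec_mul lc gS (sharp_letters lr) ppn rp.
have [l [ll kl lk]] := sharpP sk.
apply: nf => //; apply: prec_trans rk _; apply: prec_mul2l => //.
by apply: prec_trans kl _; apply: IHm => //; exact: prec_trans kn.
Qed.

Lemma path_from_label p : Q p -> is_label (S := S) (path_from p) p.
Proof.
move=> Qp; split; first exact: pair_letters.
  by exists 0%N; exact: prec_refl.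
by move=> r lr [m]; exact: prefix_label.
Qed.

Lemma path_from_next p : Q p -> shift p (path_from p) = path_from (next p).
Proof.
move=> Qp; have [Qn pn _] := nextP Qp.
have ppn m : dom p = cod (prefix m (next p)) by rewrite prefix_cod.
apply/seteqP; split=> x.
  move=> [px [m pxm]]; exists m; apply: (prec_cancel lc px (ppn m)).
  by apply: prec_trans pxm _; exact: prefix_prec.
move=> [m xm]; have px : dom p = cod x by rewrite (ppn m) (prec_cod xm).
by split=> //; exists m.+1; exact: prec_mul2l.
Qed.

Lemma path_from_shift m p : Q p ->
  shift (prefix m p) (path_from p) = path_from (iter m.+1 next p).
Proof.
elim: m p => [|m IHm] p Qp; first exact: path_from_next.
have [Qn pn _] := nextP Qp.
rewrite [prefix _ _]/= -shift_shift ?prefix_cod // path_from_next //.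
by rewrite IHm // -iterSr.
Qed.

Lemma path_from_paths p : Q p -> paths Q (path_from p).
Proof.
have cof q : Q q -> forall b, path_from q b -> exists y, [/\ dom b = cod y,
    path_from q (mul b y) &
    [set path_from q | q in Q] (shift (mul b y) (path_from q))].
  move=> Qq b [m /precP[y by_ e]]; exists y; rewrite -e; split=> //.
    by exists m; exact: prec_refl.
  rewrite path_from_shift //; exists (iter m.+1 next q) => //.
  by elim: m.+1 => [//|n Qn] /=; have [] := nextP Qn.
move=> Qp; apply: (paths_cofinal (Y := [set path_from q | q in Q])).
- move=> _ [q Qq <-]; split; [exact: path_from_ideal | exact: cof|].
  by move=> q' lq'; rewrite (lunique lq' (path_from_label Qq)).
- exact: path_from_ideal.
- exact: cof.
Qed.

End Realization.

Lemma labels_paths : labels (paths Q) = Q.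
Proof.
apply/seteqP; split=> p; first by move=> [F PF]; exact: paths_label.
move=> Qp; have [next nextP] := choice pair_next.
by exists (path_from next p); [exact: path_from_paths | exact: path_from_label].
Qed.

End PathsOfPair.
End Correspondence.

(** * Characters and order ideals *)

Lemma In_tnth (T : Type) (s : seq T) (x : T) :
  List.In x s <-> exists i, x = tnth (in_tuple s) i.
Proof. by rewrite In_mem; split=> /(@tnthP _ {classic T} (in_tuple s)). Qed.

Section Characters.
Context {C : smallCategory} (lc : left_cancellative C) (fa : finitely_aligned C).
Implicit Types (a b c x y z : C) (F G A B : set C) (s t : set (C * C)).
Implicit Types (chi : charSpace C) (e f g : @J C).

Lemma Il_dom s x y : Il s -> s (x, y) -> dom x = dom y.
Proof.
move=> Is; elim: Is x y => {s}.
- by move=> c x y [cx /= ->]; rewrite dom_mul.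
- by move=> s _ IHs x y syx; rewrite (IHs y x).
- by move=> s t _ IHs _ IHt x y [z txz szy]; rewrite (IHt x z) // (IHs z y).
Qed.

Lemma Il_inj s x x' y y' : Il s -> s (x, y) -> s (x', y') -> x = x' <-> y = y'.
Proof.
move=> Is; elim: Is x x' y y' => {s}.
- move=> c x x' y y' [/= cx ->] [/= cx' ->].
  by split=> [->//|]; exact: lc.
- by move=> s _ IHs x x' y y' sx sx'; rewrite (IHs y y' x x').
- move=> s t _ IHs _ IHt x x' y y' [z tz sz] [z' tz' sz'].
  by rewrite (IHt _ _ _ _ tz tz') (IHs _ _ _ _ sz sz').
Qed.

Lemma Il_mulr s x y z : Il s -> s (x, y) -> dom x = cod z ->
  s (mul x z, mul y z).
Proof.
move=> Is; elim: Is x y => {s}.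
- by move=> c x y [/= cx ->] xz; split=> /=; rewrite ?cod_mul ?mulA.
- by move=> s Is IHs x y syx xz; apply: IHs => //; rewrite (Il_dom Is syx).
- move=> s t _ IHs It IHt x y [w txw swy] xz; exists (mul w z); first exact: IHt.
  by apply: IHs => //; rewrite -(Il_dom It txw).
Qed.

Lemma pdom_prec s a b : Il s -> prec a b -> pdom s a -> pdom s b.
Proof.
move=> Is /precP[z az ->] [y say]; exists (mul y z); exact: Il_mulr.
Qed.

Definition covered A B := exists2 l : seq C, (forall a, List.In a l -> A a)
  & forall x, B x -> exists2 a, List.In a l & prec a x.

Lemma covered_list (T : Type) (m : seq T) A (B : T -> set C) :
  (forall p, List.In p m -> covered A (B p)) ->
  covered A [set x | exists2 p, List.In p m & B p x].
Proof.
elim: m => [|p m IHm] mB; first by exists [::] => // x [].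
have [l lA lB] := mB p (or_introl erefl).
have [|l' lA' lB'] := IHm; first by move=> q qm; apply: mB; right.
exists (l ++ l') => [a /List.in_app_iff[/lA|/lA']//|x [q [<-|qm] Bx]].
  by have [a al ax] := lB _ Bx; exists a => //; apply/List.in_app_iff; left.
have [|a al ax] := lB' x; first by exists q.
by exists a => //; apply/List.in_app_iff; right.
Qed.

(** If [s] maps [a] to [b], then it maps [a C] onto [b C]. The part of [b C]
    inside the domain of [t] is covered by the finitely many common multiples
    of [b] with generators [c] of that domain. *)
Lemma covered_comp s t : Il s -> Il t -> covered (pdom s) (pdom s) ->
  covered (pdom t) (pdom t) ->
  covered (pdom (t \; s)%relation) (pdom (t \; s)%relation).
Proof.
move=> Is It [l ls lC] [m mt mC].
suff [k kst kC] : covered (pdom (t \; s)%relation)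
    [set x | exists2 a, List.In a l & [set x | exists2 c, List.In c m &
      [set x | exists y, [/\ prec a x, s (x, y) & prec c y]] x] x].
  exists k => // x [w [y sxy tyw]]; apply: kC.
  have [|a al ax] := lC x; first by exists y.
  have [|c cm cy] := mC y; first by exists w.
  by exists a => //; exists c => //; exists y.
apply: covered_list => a al; apply: covered_list => c cm.
have [[b sab] [d tcd]] := (ls _ al, mt _ cm).
have ab := Il_dom Is sab.
have [k kP] := aligned_list fa b c.
suff [n nst nC] : covered (pdom (t \; s)%relation)
    [set x | exists2 e, List.In e k & [set x | exists y,
      [/\ prec a x, s (x, y) & prec e y]] x].
  exists n => // x [y [/precP[z az ->] sxy cy]]; apply: nC.
  have bz : dom b = cod z by rewrite -ab.
  have yE : mul b z = y by exact: (Il_inj Is (Il_mulr Is sab az) sxy).1.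
  have [|e ek ey] := (kP y).1; first by rewrite -yE; split; [exact: prec_mulr|rewrite yE].
  by exists e => //; exists y; split=> //; exact: prec_mulr.
apply: covered_list => e ek.
have [|/precP[z bz eE] ce] := (kP e).2.
  by exists e => //; exact: prec_refl.
have az : dom a = cod z by rewrite ab.
have saz := Il_mulr Is sab az; rewrite -eE in saz.
exists [:: mul a z] => [_ [<-|[]]|x].
  have [d' td'] := pdom_prec It ce (mt _ cm).
  by exists d', e.
move=> [y [/precP[w aw ->] sxy ey]]; exists (mul a z); first by left.
apply: prec_mul2l => //; have bw : dom b = cod w by rewrite -ab.
have yE : mul b w = y by exact: (Il_inj Is (Il_mulr Is sab aw) sxy).1.
by apply: (prec_cancel lc bz bw); rewrite yE -eE.
Qed.

(** Ranges are included so that the induction passes through inverses. *)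
Lemma Il_covered s : Il s ->
  covered (pdom s) (pdom s) /\ covered (pdom s^-1%relation) (pdom s^-1%relation).
Proof.
elim=> {s}.
- move=> c; split.
    exists [:: dom c] => [_ [<-|[]]|x [y [/= cx _]]].
      by exists c; rewrite /transl /= cod_dom mul_id.
    by exists (dom c); [left|rewrite cx; exact: cod_prec].
  exists [:: c] => [_ [<-|[]]|x [y [/= cy ->]]].
    by exists (dom c); rewrite /transl /= cod_dom mul_id.
  by exists c; [left|exact: prec_mulr].
- by move=> s _ [].
- move=> s t Is [s1 s2] It [t1 t2]; split; first exact: covered_comp.
  have : covered (pdom (t^-1 \; s^-1)%relation) (pdom (t^-1 \; s^-1)%relation).
    by apply: covered_comp => //; exact: Il_inv.
  suff -> : ((s \; t)^-1 = t^-1 \; s^-1)%relation by [].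
  by apply/seteqP; split=> -[x y] [z ? ?]; exists z.
Qed.

Lemma J_prec e a b : prec a b -> val e a -> val e b.
Proof. by have [s Is <-] := set_valP e; exact: pdom_prec. Qed.

Lemma J_list e : exists l, forall x,
  val e x <-> exists2 a, List.In a l & prec a x.
Proof.
have [s Is sE] := set_valP e; have [[l lA lC] _] := Il_covered Is.
exists l => x; rewrite -sE; split; first exact: lC.
by move=> [a /lA al ax]; exact: pdom_prec al.
Qed.

Lemma J_below_proof c : @J C [set x | prec c x].
Proof.
exists (transl c)^-1%relation; first exact/Il_inv/Il_transl.
apply/seteqP; split=> x; first by move=> [y [/= cy ->]]; exact: prec_mulr.
by move=> /precP[y cy ->]; exists y.
Qed.

Definition principal c : @J C := SigSub (mem_set (J_below_proof c)).

Lemma J_setI c e : exists g, val g = val (principal c) `&` val e.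
Proof.
have Is : Il (transl c \; (transl c)^-1)%relation.
  by apply: Il_comp; [|apply: Il_inv]; exact: Il_transl.
exists (pullback (SigSub (mem_set Is)) e).
apply/seteqP; split=> x /=.
  by move=> [y [z [/= cz ->] [/= _ ->]] ey]; split=> //; exact: prec_mulr.
by move=> [/precP[y cy ->] ex]; exists (mul c y) => //; exists y.
Qed.

Definition char_of F : charSpace C := fun e => `[< exists2 c, F c & val e c >].

Definition ideal_of chi : set C := [set c | chi (principal c)].

Lemma Omega_mono chi e f : Omega chi -> val e `<=` val f -> chi e -> chi f.
Proof.
move=> [[_ mult _] _] ef che; have := mult e f e (esym (setIidl ef)).
by rewrite che => /esym.
Qed.

Lemma Omega_cover chi e (l : seq C) : Omega chi ->
  (forall x, val e x -> exists2 a, List.In a l & prec a x) ->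
  (forall a, List.In a l -> val e a) -> chi e ->
  exists2 a, List.In a l & chi (principal a).
Proof.
move=> [_ cov] el le che.
pose f (i : 'I_(size l)) := principal (tnth (in_tuple l) i).
have [|//|i chi_i] := cov e (size l) f; last first.
  by exists (tnth (in_tuple l) i) => //; apply/In_tnth; exists i.
apply/seteqP; split=> x.
  by move=> /el[a /In_tnth[i ->] ax]; exists i.
move=> [i _ /= ix]; apply: J_prec ix _; apply: le.
by apply/In_tnth; exists i.
Qed.

Lemma ideal_ofP chi e : Omega chi ->
  chi e <-> exists2 c, ideal_of chi c & val e c.
Proof.
move=> Oc; split=> [che|[c cc ec]].
  have [l lP] := J_list e.
  have le a : List.In a l -> val e a.
    by move=> al; apply/lP; exists a => //; exact: prec_refl.
  have [|a al ca] := Omega_cover Oc _ le che; first by move=> x /lP.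
  by exists a => //; exact: le.
by apply: Omega_mono cc => // x cx; exact: J_prec cx ec.
Qed.

Lemma ideal_of_ideal chi : Omega chi -> order_ideal (ideal_of chi).
Proof.
move=> Oc; have [[[e che] mult _] _] := Oc; split.
- by have /(ideal_ofP _ Oc)[c cc _] := che; exists c.
- move=> a b ab; apply: Omega_mono => // x; exact: prec_trans.
- move=> a b ca cb; have [g gE] := J_setI a (principal b).
  have /(ideal_ofP _ Oc)[c cc] : chi g by rewrite (mult _ _ _ gE) ca cb.
  by rewrite gE => -[]; exists c.
Qed.

Lemma char_of_Omega F : order_ideal F -> Omega (char_of F).
Proof.
move=> [[a Fa] dc di]; split; [split|].
- by exists (principal a); apply/asboolP; exists a => //; exact: prec_refl.
- move=> e f g gE; apply/asboolP/andP => [[c Fc]|].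
    by rewrite gE => -[? ?]; split; apply/asboolP; exists c.
  move=> [/asboolP[c Fc ec] /asboolP[d Fd fd]].
  have [x [Fx cx dx]] := di _ _ Fc Fd; exists x => //.
  by rewrite gE; split; [exact: J_prec cx ec | exact: J_prec dx fd].
- by move=> e e0; apply/asboolP => -[c _]; rewrite e0.
- move=> e n f ef /asboolP[c Fc]; rewrite ef => -[i _ fc].
  by exists i; apply/asboolP; exists c.
Qed.

Lemma ideal_of_char F : order_ideal F -> ideal_of (char_of F) = F.
Proof.
move=> [_ dc _]; apply/seteqP; split=> a.
  by move=> /asboolP[c Fc ac]; exact: dc Fc.
by move=> Fa; apply/asboolP; exists a => //; exact: prec_refl.
Qed.

Lemma char_of_ideal chi : Omega chi -> char_of (ideal_of chi) = chi.
Proof.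
move=> Oc; apply/funext => e; apply/idP/idP.
  by move=> /asboolP/(ideal_ofP _ Oc).
by move=> /(ideal_ofP _ Oc) ?; apply/asboolP.
Qed.

(** As [F] is directed, it meets a right ideal exactly when it contains a right
    multiple of [a] in this ideal, and on those [s] is [a x |-> b x]. *)
Lemma act_char_of (s : @Il C) F a b : order_ideal F -> F a -> val s (a, b) ->
  act s (char_of F) = char_of (push b (shift a F)).
Proof.
move=> [_ dc di] Fa sab; have Is : Il (val s) by exact: set_valP s.
have ab := Il_dom Is sab.
apply/funext => e; apply/asboolP/asboolP.
  move=> [x Fx [y sxy ey]].
  have [w [Fw xw /precP[z az wE]]] := di _ _ Fx Fa; subst w.
  have [v xv xvE] : exists2 v, dom x = cod v & mul a z = mul x v by apply/precP.
  have yvE : mul b z = mul y v.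
    apply: (Il_inj Is (Il_mulr Is sab az) _).1 xvE.
    exact: Il_mulr.
  exists (mul b z); first by exists z; rewrite -ab; split=> //; exact: prec_refl.
  rewrite yvE; apply: J_prec ey; apply: prec_mulr.
  by rewrite -(Il_dom Is sxy).
move=> [y [z [[az Faz] bz yz]] ey].
exists (mul a z) => //; exists (mul b z); first exact: Il_mulr.
exact: J_prec yz ey.
Qed.

(** The sets of characters with prescribed values at finitely many elements of
    [J] form a basis of the topology of pointwise convergence. *)
Lemma closed_in_Omega (X : set (charSpace C)) : X `<=` @Omega C ->
  closed (X : set (subspace (@Omega C))) <->
  forall chi, Omega chi ->
    (forall l, exists2 chi', X chi' & forall e, List.In e l -> chi' e = chi e) ->
    X chi.
Proof.
move=> XO; split.
  move=> /closed_subspaceP[V cV VX] chi Oc apx.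
  suff : (V `&` @Omega C) chi by rewrite VX => -[].
  split=> //; apply: cV.
  pose cyl (l : seq (@J C)) : set (charSpace C) :=
    [set chi' | forall e, List.In e l -> chi' e = chi e].
  have XV : X `<=` V.
    move=> x Xx; have : (X `&` @Omega C) x by split=> //; exact: XO.
    by rewrite -VX => -[].
  pose FF : set_system (charSpace C) := filter_from setT cyl.
  have FFf : Filter FF.
    apply: filter_from_filter; first by exists [::].
    move=> l m _ _; exists (l ++ m) => // x xlm.
    by split=> e el; apply: xlm; apply/List.in_app_iff; [left|right].
  have cF : FF --> chi.
    apply/cvg_sup => e A [V' [[W oW <-] We] WA]; exists [:: e] => // x xe.
    by apply: WA; rewrite /= (xe e (or_introl erefl)).
  move=> A chiA; have [l _ lA] := cF _ chiA; have [chi' Xc lc'] := apx l.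
  by exists chi'; split; [exact: XV | exact: lA].
move=> cl; apply/closed_subspaceP; exists (closure X); first exact: closed_closure.
apply/seteqP; split=> chi [] => [cX Oc|Xc Oc]; last by split=> //; exact: subset_closure.
split=> //; apply: cl => // l.
have nl : nbhs chi [set chi' | forall e, List.In e l -> chi' e = chi e].
  elim: l => [|e l IHl]; first by apply: filterS filterT => x _ e [].
  have ne : nbhs chi [set chi' : charSpace C | chi' e = chi e].
    have pc := @proj_continuous _ (fun _ : @J C => bool) e chi.
    exact: (pc [set chi e] (discrete_set1 _)).
  by apply: filterS (filterI ne IHl) => x [/= xe xl] f [<-|/xl].
by have [chi' [Xc lc']] := cX _ nl; exists chi'.
Qed.

Definition family_of (X : set (charSpace C)) : set (set C) :=
  [set F | order_ideal F /\ X (char_of F)].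

Lemma family_of_closed X : closed_invariant X -> closed_family (family_of X).
Proof.
move=> [XO /(closed_in_Omega XO) cX inv]; split; first by move=> F [].
- move=> F oF apx; split=> //; apply: cX; first exact: char_of_Omega.
  move=> m.
  have [l lP] : exists l, forall G, agree_on l F G -> forall e, List.In e m ->
      order_ideal G -> char_of G e = char_of F e.
    elim: m => [|e m [l lP]]; first by exists [::].
    have [k kP] := J_list e; exists (k ++ l) => G aG e' [<-|em] oG; last first.
      by apply: lP => // c cl; apply: aG; apply/List.in_app_iff; right.
    have FG c : List.In c k -> G c <-> F c.
      by move=> ck; apply: aG; apply/List.in_app_iff; left.
    have gen H : order_ideal H -> (exists2 c, H c & val e c) <->
        exists2 c, List.In c k & H c.
      move=> [_ dc _]; split=> [[c Hc /kP[a ak ac]]|[c ck Hc]].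
        by exists a => //; exact: dc Hc.
      by exists c => //; apply/kP; exists c => //; exact: prec_refl.
    apply/asboolP/asboolP => /gen; [move=> /(_ oG)|move=> /(_ oF)];
    by move=> [c ck /(FG _ ck) Hc]; apply/gen => //; exists c.
  have [G [oG XG] aG] := apx l.
  by exists (char_of G) => // e em; exact: lP.
- move=> F a b [oF XF] Fa ab; split.
    apply: push_ideal; first exact: shift_ideal.
    by exists (dom a); rewrite ?cod_dom //; split; rewrite ?cod_dom ?mul_id.
  have Is : Il (transl b \; (transl a)^-1)%relation.
    by apply: Il_comp; [|apply: Il_inv]; exact: Il_transl.
  pose s : @Il C := SigSub (mem_set Is).
  have sab : val s (a, b).
    by exists (dom a); rewrite /transl /= cod_dom ?mul_id // ab mul_id.
  rewrite -(act_char_of oF Fa sab); apply: inv => //.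
  by apply/asboolP; exists a => //; exists b.
Qed.

Lemma family_of_inj X X' : X `<=` @Omega C -> X' `<=` @Omega C ->
  family_of X = family_of X' -> X = X'.
Proof.
move=> XO XO' e; apply/seteqP; split=> chi Xc.
  have : family_of X (ideal_of chi).
    by split; rewrite ?char_of_ideal //; [exact/ideal_of_ideal/XO | exact: XO].
  by rewrite e => -[_]; rewrite char_of_ideal //; exact: XO.
have : family_of X' (ideal_of chi).
  by split; rewrite ?char_of_ideal //; [exact/ideal_of_ideal/XO' | exact: XO'].
by rewrite -e => -[_]; rewrite char_of_ideal //; exact: XO'.
Qed.

Lemma family_of_surj (Y : set (set C)) : closed_family Y ->
  exists2 X, closed_invariant X & family_of X = Y.
Proof.
move=> [YI cl inv]; exists [set chi | Omega chi /\ Y (ideal_of chi)]; last first.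
  apply/seteqP; split=> F.
    by move=> [oF [_]]; rewrite ideal_of_char.
  move=> YF; have oF := YI _ YF; split=> //; split; first exact: char_of_Omega.
  by rewrite ideal_of_char.
have XO : [set chi | Omega chi /\ Y (ideal_of chi)] `<=` @Omega C by move=> chi [].
split=> //.
  apply/(closed_in_Omega XO) => chi Oc apx; split=> //.
  apply: cl; first exact: ideal_of_ideal.
  move=> l; have [chi' [_ Yc] cc] := apx (map principal l).
  exists (ideal_of chi') => // c cl'.
  by rewrite /ideal_of /= cc //; exact: List.in_map.
move=> s chi [Oc Yc] /(ideal_ofP _ Oc)[a ca [b sab]].
have oF := ideal_of_ideal Oc; have Is : Il (val s) by exact: set_valP s.
have ab := Il_dom Is sab.
rewrite -(char_of_ideal Oc) (act_char_of oF ca sab).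
have oG : order_ideal (push b (shift a (ideal_of chi))).
  apply: push_ideal; first exact: shift_ideal.
  by exists (dom a); rewrite ?cod_dom //; split; rewrite ?cod_dom ?mul_id.
split; first exact: char_of_Omega.
by rewrite ideal_of_char //; exact: inv.
Qed.

End Characters.

Theorem theorem2 (C : smallCategory) (S : set C) :
  countable [set: C] -> left_cancellative C -> finitely_aligned C ->
  garside S -> S `&` @units C = set0 -> transverse S -> locally_bounded S ->
  exists F : set (charSpace C) -> set C * set C,
    set_bij (@closed_invariant C) (good_pairs S) F.
Proof.
move=> cC lc fa gS SU trS lbS.
pose L (X : set (charSpace C)) := labels (S := S) (family_of X).
exists (fun X => (L X `&` S, L X `&` @objects C)); split.
- by move=> X /(family_of_closed lc fa) cX; exact: labels_good.
- move=> X X' /set_mem cX /set_mem cX' [eS eO].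
  have [[XO _ _] [XO' _ _]] := (cX, cX').
  apply: (family_of_inj lc fa XO XO').
  rewrite -(paths_labels lc gS lbS (family_of_closed lc fa cX)).
  rewrite -(paths_labels lc gS lbS (family_of_closed lc fa cX')).
  congr (paths _); rewrite -/(L X) -/(L X').
  rewrite -(labels_split (@labels_letters _ S (family_of X) : L X `<=` _)) -/(L X) eS eO.
  by rewrite (labels_split (@labels_letters _ S (family_of X') : L X' `<=` _)).
- move=> [T D] [/= [TS DO] adm inv mcl iso].
  have cP := paths_family lc gS SU trS lbS TS DO inv mcl iso cC.
  have [X cX XE] := family_of_surj lc fa cP; exists X => //.
  rewrite /L XE (labels_paths lc gS SU trS lbS TS DO adm inv iso).
  have disj s : S s -> ~ objects s by exact: S_nonobject.
  congr pair; apply/seteqP; split=> x.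
  + by move=> [[//|/DO ox] Sx]; case: (disj _ Sx).
  + by move=> Tx; split; [left | exact: TS].
  + by move=> [[/TS Sx|//] ox]; case: (disj _ Sx).
  + by move=> Dx; split; [right | exact: DO].
Qed.
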